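(* Let $k$ be a field of characteristic $p\neq 0$ and let $(A,r)$ be a quasitriangular $\epsilon$-bialgebra over $k$, with $r=\sum_i u_i\otimes v_i\in A\otimes A$. Then $A$ is equipped with the structure of a restricted pre-Lie algebra; that is, for the pre-Lie product $\{x,y\}:=x\succ y-y\prec x$ coming from the dendriform algebra structure $x\succ y:=\sum_i u_i x v_i y$, $x\prec y:=\sum_i x u_i y v_i$ associated with $(A,r)$, there is a map $(-)^{[p]}:A\to A$ such that $(A,\{-,-\},(-)^{[p]})$ is a restricted pre-Lie algebra.
   Context: An infinitesimal bialgebra ($\epsilon$-bialgebra) is a triple $(A,\mu,\Delta)$ with $(A,\mu)$ an associative $k$-algebra, $(A,\Delta)$ a coassociative coalgebra (no counit required), and $\Delta:A\to A\otimes A$ a derivation, $\Delta(ab)=a\Delta(b)+\Delta(a)b$, where $a(u\otimes v)=au\otimes v$ and $(u\otimes v)a=u\otimes va$. A quasitriangular $\epsilon$-bialgebra is a pair $(A,r)$ with $A$ an associative algebra and $r=\sum_i u_i\otimes v_i\in A\otimes A$ a solution of the associative Yang-Baxter equation $\sum_{i,j}u_iu_j\otimes v_j\otimes v_i-\sum_{i,j}u_i\otimes v_iu_j\otimes v_j+\sum_{i,j}u_j\otimes u_i\otimes v_iv_j=0$; it is an $\epsilon$-bialgebra with $\Delta(a)=\sum_i au_i\otimes v_i-\sum_i u_i\otimes v_ia$. By a known result of Aguiar, the operations $x\succ y:=\sum_i u_ixv_iy$ and $x\prec y:=\sum_i xu_iyv_i$ make $A$ a dendriform algebra, i.e. $(x\prec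 y)\prec z=x\prec(y\prec z+y\succ z)$, $(x\succ y)\prec z=x\succ(y\prec z)$, $(x\prec y+x\succ y)\succ z=x\succ(y\succ z)$; for any dendriform algebra $\{x,y\}:=x\succ y-y\prec x$ is a (left) pre-Lie product. A (left) pre-Lie algebra is a $k$-vector space $P$ with a bilinear operation $\{-,-\}:P\times P\to P$ such that $\{x,\{y,z\}\}-\{\{x,y\},z\}=\{y,\{x,z\}\}-\{\{y,x\},z\}$ for all $x,y,z\in P$. Then $[x,y]:=\{x,y\}-\{y,x\}$ is a Lie bracket on $P$. A restricted pre-Lie algebra over a field $k$ of characteristic $p\neq 0$ is a pre-Lie algebra $(P,\{-,-\})$ over $k$ together with a map $(-)^{[p]}:P\to P$ (the $p$-map) such that for all $x,y\in P$, $\alpha\in k$: (1) $(\alpha x)^{[p]}=\alpha^p x^{[p]}$; (2) $\{x^{[p]},y\}=\{x,\{x,\cdots\{x,y\}\cdots\}\}$ ($p$ copies of $x$); (3) $\{y,x^{[p]}\}=\{x,\{x,\cdots\{x,y\}\cdots\}\}-[x,[x,\cdots[x,y]\cdots]]$ ($p$ copies of $x$ in each term); (4) $(x+y)^{[p]}=x^{[p]}+y^{[p]}+\sum_{i=1}^{p-1}s_i(x,y)$, where $i\,s_i(x,y)$ is the coefficient of $\lambda^{i-1}$ in $[\lambda x+y,[\cdots,[\lambda x+y,x]\cdots]]$ with $p-1$ copies of $\lambda x+y$ ($\lambda$ a formal variable). *)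

(* Defs.v *)
From HB Require Import structures.
From mathcomp Require Import all_boot all_algebra.
From mathcomp Require Import sesquilinear generic_quotient ring_quotient.
From mathcomp Require Import boolp freeg.

Set Implicit Arguments.
Unset Strict Implicit.
Unset Printing Implicit Defensive.

Import GRing.Theory.
Local Open Scope ring_scope.
Local Open Scope quotient_scope.

(* U \ot V is the free k-module on U * V modulo the submodule spanned by the
   bilinearity relators. *)
Section TensorProduct.
Context (k : fieldType) (U V : lmodType k).

Local Notation free := {freeg (U * V)%type / k}.
Local Notation gen u v := (<< ((u, v) : (U * V)%type) >> : free).

Inductive tensor_relator : free -> Prop :=
| relator_addl u u' v : tensor_relator (gen (u + u') v - gen u v - gen u' v)
| relator_addr u v v' : tensor_relator (gen u (v + v') - gen u v - gen u v')
| relator_scalel a u v : tensor_relator (gen (a *: u) v - a *: gen u v)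
| relator_scaler a u v : tensor_relator (gen u (a *: v) - a *: gen u v).

Inductive tensor_null : free -> Prop :=
| tensor_null0 : tensor_null 0
| tensor_nullD a x y :
    tensor_relator x -> tensor_null y -> tensor_null (a *: x + y).

Lemma tensor_null_add x y : tensor_null x -> tensor_null y -> tensor_null (x + y).
Proof.
move=> nx ny; elim: nx => [|a z t rz _ IH]; first by rewrite add0r.
by rewrite -addrA; exact: tensor_nullD.
Qed.

Lemma tensor_null_scale b x : tensor_null x -> tensor_null (b *: x).
Proof.
elim=> [|a z t rz _ IH]; first by rewrite scaler0; exact: tensor_null0.
by rewrite scalerDr scalerA; exact: tensor_nullD.
Qed.

Lemma tensor_relator_null x : tensor_relator x -> tensor_null x.
Proof.
by move=> rx; rewrite -[x]scale1r -[_ *: _]addr0; apply: tensor_nullD => //; exact: tensor_null0.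
Qed.

Definition tensor_ker (x : free) : bool := `[< tensor_null x >].

Lemma tensor_ker_zmod_closed : zmod_closed tensor_ker.
Proof.
split; first by apply/asboolP; exact: tensor_null0.
move=> x y /asboolP nx /asboolP ny; apply/asboolP.
by apply: tensor_null_add => //; rewrite -scaleN1r; exact: tensor_null_scale.
Qed.

Definition tensor_ker_zmod : zmodClosed free :=
  HB.pack tensor_ker
    (GRing.isZmodClosed.Build free tensor_ker tensor_ker_zmod_closed).

Definition tensor : Type := Quotient.quot tensor_ker_zmod.

HB.instance Definition _ := Choice.on tensor.
HB.instance Definition _ := EqQuotient.on tensor.
HB.instance Definition _ := GRing.Zmodule.on tensor.
HB.instance Definition _ := @isZmodQuotient.Build
  free (Quotient.equiv tensor_ker_zmod) 0 -%R +%R tensor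
  (lock _) (@Quotient.pi_opp _ _) (@Quotient.pi_add _ _).

Lemma tensor_eqP (x y : free) :
  \pi_tensor x = \pi_tensor y <-> tensor_null (x - y).
Proof.
split=> [/eqP|nxy].
  by rewrite -[_ == _](Quotient.idealrBE tensor_ker_zmod) => /asboolP.
by apply/eqP; rewrite -[_ == _](Quotient.idealrBE tensor_ker_zmod); apply/asboolP.
Qed.

Definition tensor_scale (a : k) (t : tensor) : tensor :=
  \pi_tensor (a *: (repr t : free)).

Lemma tensor_scale_pi a (x : free) :
  tensor_scale a (\pi_tensor x) = \pi_tensor (a *: x).
Proof.
rewrite /tensor_scale; apply/tensor_eqP; rewrite -scalerBr.
by apply: tensor_null_scale; apply/tensor_eqP; rewrite reprK.
Qed.

Lemma tensor_piP (t : tensor) : exists x : free, t = \pi_tensor x.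
Proof. by exists (repr t); rewrite reprK. Qed.

Lemma tensor_scaleA a b t : tensor_scale a (tensor_scale b t) = tensor_scale (a * b) t.
Proof. by have [x ->] := tensor_piP t; rewrite !tensor_scale_pi scalerA. Qed.

Lemma tensor_scale1 : left_id 1 tensor_scale.
Proof. by move=> t; have [x ->] := tensor_piP t; rewrite tensor_scale_pi scale1r. Qed.

Lemma tensor_scaleDr : right_distributive tensor_scale +%R.
Proof.
move=> a s t; have [x ->] := tensor_piP s; have [y ->] := tensor_piP t.
by rewrite -raddfD !tensor_scale_pi scalerDr raddfD.
Qed.

Lemma tensor_scaleDl t : {morph tensor_scale^~ t : a b / a + b}.
Proof.
by move=> a b; have [x ->] := tensor_piP t; rewrite !tensor_scale_pi scalerDl raddfD.
Qed.

HB.instance Definition _ := GRing.Zmodule_isLmodule.Build k tensor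
  tensor_scaleA tensor_scale1 tensor_scaleDr tensor_scaleDl.

Definition tens (u : U) (v : V) : tensor := \pi_tensor (gen u v).

Lemma tens_bilinear : bilinear_for *:%R *:%R tens.
Proof.
have addl u u' v : tens (u + u') v = tens u v + tens u' v.
  rewrite /tens -raddfD; apply/tensor_eqP/tensor_relator_null.
  by rewrite opprD addrA; exact: relator_addl.
have addr u v v' : tens u (v + v') = tens u v + tens u v'.
  rewrite /tens -raddfD; apply/tensor_eqP/tensor_relator_null.
  by rewrite opprD addrA; exact: relator_addr.
have scl a u v : tens (a *: u) v = a *: tens u v.
  rewrite /tens [RHS]tensor_scale_pi; apply/tensor_eqP/tensor_relator_null.
  exact: relator_scalel.
have scr a u v : tens u (a *: v) = a *: tens u v.
  rewrite /tens [RHS]tensor_scale_pi; apply/tensor_eqP/tensor_relator_null.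
  exact: relator_scaler.
by split=> [v|u] a x y /=; rewrite ?addl ?addr ?scl ?scr.
Qed.

HB.instance Definition _ :=
  bilinear_isBilinear.Build k U V tensor *:%R *:%R tens tens_bilinear.

End TensorProduct.

Notation "u \ot v" := (tens u v) (at level 40, left associativity) : ring_scope.

Section TensorLift.
Context (k : fieldType) (U V W : lmodType k).
Variable f : U -> V -> W.
Hypothesis f_bil : bilinear_for *:%R *:%R f.

Lemma tensor_lift_ex :
  exists2 g : tensor U V -> W, GRing.linear_for *:%R g & forall u v, g (u \ot v) = f u v.
Proof.
pose F (x : {freeg (U * V)%type / k}) := fglift (fun w : U * V => f w.1 w.2) x.
have FB x y : F (x - y) = F x - F y by exact: lift_is_additive.
have F0 : F 0 = 0 by rewrite -(subrr 0) FB subrr.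
have FN x : F (- x) = - F x by rewrite -sub0r FB F0 sub0r.
have FD x y : F (x + y) = F x + F y by rewrite -{1}[y]opprK FB FN opprK.
have FU u v : F << ((u, v) : U * V) >> = f u v by rewrite /F liftU scale1r.
have FZU a b w : F (a *: << b *g w >>) = a *: F << b *g w >>.
  suff -> : a *: << b *g w >> = << a * b *g w >> :> {freeg (U * V)%type / k}.
    by rewrite /F !liftU scalerA.
  by apply/eqP/freeg_eqP => z; rewrite coeffZ !coeffU mulrA.
have FZ a x : F (a *: x) = a *: F x.
  rewrite -[x]freeg_sumE; elim: (dom x) => [|z s IH].
    by rewrite big_nil scaler0 F0 scaler0.
  by rewrite big_cons scalerDr !FD FZU IH scalerDr.
have fDl u u' v : f (u + u') v = f u v + f u' v.
  by have /= := f_bil.1 v 1 u u'; rewrite !scale1r.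
have fDr u v v' : f u (v + v') = f u v + f u v'.
  by have /= := f_bil.2 u 1 v v'; rewrite !scale1r.
have f0l v : f 0 v = 0 by apply: (addIr (f 0 v)); rewrite -fDl !add0r.
have f0r u : f u 0 = 0 by apply: (addIr (f u 0)); rewrite -fDr !add0r.
have fZl a u v : f (a *: u) v = a *: f u v.
  by have /= := f_bil.1 v a u 0; rewrite !(addr0, f0l).
have fZr a u v : f u (a *: v) = a *: f u v.
  by have /= := f_bil.2 u a v 0; rewrite !(addr0, f0r).
have Fnull x : tensor_null x -> F x = 0.
  elim=> // a z t rz _ IH; rewrite FD IH addr0 FZ.
  suff -> : F z = 0 by rewrite scaler0.
  case: rz => *; rewrite !FB ?FZ !FU ?fDl ?fDr ?fZl ?fZr ?subrr //.
    by rewrite -addrA -opprD subrr.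
  by rewrite -addrA -opprD subrr.
have Fpi x : F (repr (\pi_(tensor U V) x)) = F x.
  apply/eqP; rewrite -subr_eq0 -FB Fnull //.
  by apply/tensor_eqP; rewrite reprK.
exists (fun t => F (repr t)) => [a s t|u v].
  have [x ->] := tensor_piP s; have [y ->] := tensor_piP t.
  by rewrite [a *: _]tensor_scale_pi -raddfD !Fpi FD FZ.
by rewrite Fpi FU.
Qed.

End TensorLift.

Section Quasitriangular.
Context (k : fieldType) (A : lmodType k).
Implicit Types (mul : A -> A -> A) (r : tensor A A).

(* Each of the three sums is multilinear in r, so the condition does not depend
   on the chosen decomposition of r. *)
Definition AYBE mul r : Prop :=
  exists (n : nat) (u v : 'I_n -> A),
    r = \sum_i u i \ot v i /\
    \sum_i \sum_j mul (u i) (u j) \ot v j \ot v i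
    - \sum_i \sum_j u i \ot mul (v i) (u j) \ot v j
    + \sum_i \sum_j u j \ot u i \ot mul (v i) (v j) = 0.

(* A need not have a unit, hence a bilinear product on a module rather than the
   library's (unital) algType. *)
Definition quasitriangular_eps_bialgebra mul r : Prop :=
  [/\ bilinear_for *:%R *:%R mul, associative mul & AYBE mul r].

Definition dend_succ mul n (u v : 'I_n -> A) (x y : A) : A :=
  \sum_i mul (mul (mul (u i) x) (v i)) y.

Definition dend_prec mul n (u v : 'I_n -> A) (x y : A) : A :=
  \sum_i mul (mul (mul x (u i)) y) (v i).

Definition prelie_prod mul n (u v : 'I_n -> A) (x y : A) : A :=
  dend_succ mul u v x y - dend_prec mul u v y x.

End Quasitriangular.

Section RestrictedPreLie.
Context (k : fieldType) (P : lmodType k).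
Implicit Types br : P -> P -> P.

Definition pre_lie br : Prop :=
  bilinear_for *:%R *:%R br /\
  forall x y z,
    br x (br y z) - br (br x y) z = br y (br x z) - br (br y x) z.

Definition lie_bracket br (x y : P) : P := br x y - br y x.

(* A polynomial in the formal variable lambda with coefficients in P is encoded
   by its coefficient sequence nat -> P, and a bilinear operation on P extends
   to such sequences by convolution. *)
Definition lambda_ext br (f g : nat -> P) (m : nat) : P :=
  \sum_(i < m.+1) br (f i) (g (m - i)%N).

Definition lambda_const (x : P) (m : nat) : P := if m is 0 then x else 0.

(* lambda x + y *)
Definition lambda_affine (x y : P) (m : nat) : P :=
  match m with 0 => y | 1 => x | _ => 0 end.

Definition jacobson_s br (p i : nat) (x y : P) : P :=
  i%:R^-1 *:
  iter p.-1 (lambda_ext (lie_bracket br) (lambda_affine x y)) (lambda_const x) i.-1.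

Record restricted_pre_lie (p : nat) br (pmap : P -> P) : Prop := {
  rpl_pre_lie : pre_lie br;
  rpl_scale : forall (a : k) x, pmap (a *: x) = a ^+ p *: pmap x;
  rpl_left : forall x y, br (pmap x) y = iter p (br x) y;
  rpl_right : forall x y,
    br y (pmap x) = iter p (br x) y - iter p (lie_bracket br x) y;
  rpl_add : forall x y,
    pmap (x + y) = pmap x + pmap y + \sum_(1 <= i < p) jacobson_s br p i x y
}.

End RestrictedPreLie.

(* Main.v *)
Require Import Defs.
From HB Require Import structures.
From mathcomp Require Import all_boot all_algebra.
From mathcomp Require Import sesquilinear.
From mathcomp Require boolp.

Set Implicit Arguments.
Unset Strict Implicit.
Unset Printing Implicit Defensive.

Import GRing.Theory.
Local Open Scope ring_scope.

(** Write [beta x] for the sum of the [u i * x * v i]. The pre-Lie product is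
    then [{x, y} = beta x * y - y * beta x], the commutator of [beta x] and
    [y]. Applying [a \ot b \ot c |-> a * x * b * y * c] to the associative
    Yang-Baxter equation shows that [beta] is a Rota-Baxter operator of weight
    zero: [beta x * beta y = beta (x * beta y + beta x * y)]
    ([sandwich_rota_baxter]). Everything else holds for any such operator.

    The identity says that [beta] is multiplicative from the product
    [rb_star x y = x * beta y + beta x * y] to the original one. It follows
    that [rb_star] is associative, and its commutator turns out to be
    [{x, y} - {y, x}], the Lie bracket of the pre-Lie algebra
    ([lie_rb_bracket]). The [p]-map is the [p]-th power for [rb_star]. It is
    homogeneous of degree [p], and the other axioms reduce to two classical
    facts on associative algebras of characteristic [p]:
    - [ad a] iterated [p] times is [ad (a ^+ p)]. Applied to [beta x] in the
      original algebra, where [beta] of the [p]-map of [x] is the [p]-th power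
      of [beta x], it gives the axiom on [{x^[p], y}]; applied to [x] in
      [(A, rb_star)] it computes [{x^[p], y} - {y, x^[p]}], hence
      [{y, x^[p]}].
    - Jacobson's formula for [(x + y) ^+ p]. With [c = lambda x + y], the
      derivative of [c ^+ p] in [lambda] is the sum of the
      [c ^+ (p - 1 - i) * x * c ^+ i], which in characteristic [p] is [ad c]
      iterated [p - 1] times on [x]; comparing coefficients and evaluating at
      [lambda = 1] gives the formula ([iter_mulD_pchar]).
    As [A] may lack a unit, these facts are proved in rings and transferred
    through the unitization of [A]. *)

(** * Iterated commutators and powers of sums in characteristic p *)

Section RingCommutator.
Context (R : nzRingType).
Implicit Types a b : R.

Definition commutator a b : R := a * b - b * a.

(** Left multiplication by [a] and right multiplication by [- a] commute, so
    the iterates of their sum obey the binomial formula. *)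
Lemma iter_commutator a b n :
  iter n (commutator a) b =
  \sum_(i < n.+1) a ^+ (n - i) * b * (- a) ^+ i *+ 'C(n, i).
Proof.
have -> : iter n (commutator a) b = iter n (fun z => a * z + z * - a) b.
  by apply: eq_iter => z; rewrite /commutator mulrN.
elim: n => [|n IHn]; rewrite big_ord_recl.
  by rewrite big_ord0 mul1r mulr1 addr0.
rewrite iterS IHn mulr_suml mulr_sumr [X in X + _]big_ord_recl.
rewrite [X in _ + X]big_ord_recr [X in _ = _ + X]big_ord_recr /=.
rewrite !binn !subnn !subn0 !bin0 -!addrA; congr (_ + _).
  by rewrite !mulr1 mulrA exprS.
rewrite addrA -big_split /=; congr (_ + _); last first.
  by rewrite !mulr1n !mul1r -mulrA exprSr.
apply: eq_bigr => i _; rewrite /bump /= !add1n binS mulrnDr; congr (_ + _).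
  by rewrite mulrnAr !mulrA -exprS subSS -subSn // ?subSS.
by rewrite mulrnAl -mulrA -exprSr subSS.
Qed.

Context (p : nat) (pcharRp : p \in [pchar R]).

Let p_prime : prime p := pcharf_prime pcharRp.
Let p_gt0 : (0 < p)%N := prime_gt0 p_prime.

(** The middle binomial coefficients vanish and [(- a) ^+ p = - a ^+ p]. *)
Lemma iter_commutator_pchar a b :
  iter p (commutator a) b = commutator (a ^+ p) b.
Proof.
pose F i := a ^+ (p - i) * b * (- a) ^+ i *+ 'C(p, i).
rewrite iter_commutator -(big_mkord xpredT F) big_nat_recr //= big_ltn //.
rewrite big_nat big1 => [|i ip]; last first.
  by rewrite /F -mulr_natr (bin_lt_pcharf_0 pcharRp) ?mulr0.
rewrite /F /= bin0 binn subn0 subnn !mulr1 mul1r addr0 /commutator.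
congr (_ + _); rewrite -mulrN; congr (_ * _).
exact: (pFrobenius_autN pcharRp).
Qed.

Lemma bin_pred_pchar i : (i < p)%N -> 'C(p.-1, i)%:R = (-1) ^+ i :> R.
Proof.
elim: i => [|i IHi] ip; first by rewrite bin0.
have := bin_lt_pcharf_0 pcharRp (k := i.+1) ip.
rewrite -[in 'C(_, _)](prednK p_gt0) binS natrD IHi 1?ltnW // => /eqP.
by rewrite addr_eq0 exprS mulN1r => /eqP.
Qed.

(** The binomial coefficients ['C(p.-1, i)] are the signs [(-1) ^+ i] in
    characteristic [p] and cancel those of the powers of [- a]. *)
Lemma iter_commutator_pred_pchar a b :
  iter p.-1 (commutator a) b = \sum_(i < p) a ^+ (p.-1 - i) * b * a ^+ i.
Proof.
rewrite iter_commutator prednK //; apply: eq_bigr => i _.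
rewrite -mulr_natr bin_pred_pchar // -!mulrA; congr (_ * (_ * _)).
rewrite (exprNn a) -mulrA (commr_sign (a ^+ i)) mulrA.
by rewrite -expr2 sqrr_sign mul1r.
Qed.

End RingCommutator.

Section JacobsonRing.
Context (R : nzRingType).
Implicit Types x y : R.

Lemma deriv_exp_noncomm (q : {poly R}) n :
  (q ^+ n)^`() = \sum_(i < n) q ^+ (n.-1 - i) * q^`() * q ^+ i.
Proof.
elim: n => [|n IHn]; first by rewrite big_ord0 derivC.
rewrite exprS derivM IHn big_ord_recr /= subnn mul1r addrC mulr_sumr.
congr (_ + _); apply: eq_bigr => i _; rewrite !mulrA -exprS.
congr (_ ^+ _ * _ * _).
by case: n i {IHn} => [|n] i; [case: i | rewrite -subSn // -ltnS].
Qed.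

Context (p : nat) (pcharRp : p \in [pchar R]) (x y : R).

Let p_gt0 : (0 < p)%N := prime_gt0 (pcharf_prime pcharRp).
Let affine : {poly R} := x%:P * 'X + y%:P.

(** Both sides are coefficients of the derivative of [affine ^+ p], the
    derivative of [affine] being the constant [x]. *)
Lemma coef_affine_exp_pchar i :
  (affine ^+ p)`_i.+1 *+ i.+1 = (iter p.-1 (commutator affine) x%:P)`_i.
Proof.
have pcharRXp : p \in [pchar {poly R}] by rewrite pchar_poly.
rewrite -coef_deriv deriv_exp_noncomm (iter_commutator_pred_pchar pcharRXp).
by rewrite /affine derivMXaddC derivC mul0r addr0.
Qed.

Lemma size_affine : (size affine <= 2)%N.
Proof.
by rewrite size_MXaddC; case: ifP => // _; rewrite ltnS size_polyC leq_b1.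
Qed.

Lemma coef0_affine_exp n : (affine ^+ n)`_0 = y ^+ n.
Proof.
elim: n => [|n IHn]; first by rewrite !expr0 coefC.
by rewrite !exprS coef0M IHn /affine coefD coefMX !coefC /= add0r.
Qed.

Lemma size_affine_exp n : (size (affine ^+ n) <= n.+1)%N.
Proof.
apply: leq_trans (size_poly_exp_leq _ _) _; rewrite ltnS -[leqRHS]mul1n.
by rewrite leq_mul2r -subn1 leq_subLR size_affine orbT.
Qed.

Lemma coef_affine_exp_diag n : (affine ^+ n)`_n = x ^+ n.
Proof.
elim: n => [|n IHn]; first by rewrite !expr0 coefC.
rewrite !exprS /affine mulrDl -mulrA -commr_polyX mulrA coefD coefMX /= !coefCM.
by rewrite IHn [_`_n.+1]nth_default ?mulr0 ?addr0 ?size_affine_exp.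
Qed.

(** Evaluation of [affine ^+ p] at 1. *)
Lemma exprD_affine_coef :
  (x + y) ^+ p = x ^+ p + y ^+ p + \sum_(1 <= i < p) (affine ^+ p)`_i.
Proof.
have -> : x + y = affine.[1].
  by rewrite /affine hornerD hornerMX !hornerC mulr1.
rewrite -horner_exp_comm; last by rewrite /comm_poly mulr1 mul1r.
rewrite (horner_coef_wide _ (size_affine_exp p)).
rewrite (eq_bigr (fun i : 'I_p.+1 => (affine ^+ p)`_i)); last first.
  by move=> i _; rewrite expr1n mulr1.
rewrite big_ord_recr /= coef_affine_exp_diag -(big_mkord xpredT).
by rewrite big_ltn // coef0_affine_exp addrC addrA.
Qed.

End JacobsonRing.

(** * Associative algebras without unit *)

Section Unitization.
Context (k : fieldType) (A : lmodType k).

(** The unital ring [k + A] obtained by adjoining a unit to [A]; it makes the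
    identities proved for rings available in [A]. The parameters only serve to
    attach the product to the type. *)
Definition unitization (mul : {bilinear A -> A -> A}) of associative mul :
  Type := (k * A)%type.

Context (mul : {bilinear A -> A -> A}) (mulA : associative mul).
Local Notation B := (unitization mulA).

HB.instance Definition _ := GRing.Zmodule.on B.

Definition unitization_mul (x y : B) : B :=
  (x.1 * y.1, x.1 *: y.2 + y.1 *: x.2 + mul x.2 y.2).

Fact unitization_mulA : associative unitization_mul.
Proof.
move=> [a x] [b y] [c z]; rewrite /unitization_mul /= mulrA; congr pair.
rewrite !(linearDl, linearDr, linearZl_LR, linearZr_LR) /= mulA.
rewrite !scalerDr !scalerA.
rewrite (mulrC c a) (mulrC c b) -!addrA; do 2!congr (_ + _).
rewrite addrCA; congr (_ + _); rewrite [RHS]addrCA; congr (_ + _).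
exact: addrCA.
Qed.

Fact unitization_mul1l : left_id ((1, 0) : B) unitization_mul.
Proof.
move=> [a x]; rewrite /unitization_mul /= mul1r scale1r scaler0 linear0l.
by rewrite !addr0.
Qed.

Fact unitization_mul1r : right_id ((1, 0) : B) unitization_mul.
Proof.
move=> [a x]; rewrite /unitization_mul /= mulr1 scale1r scaler0 linear0r.
by rewrite add0r addr0.
Qed.

Fact unitization_mulDl : left_distributive unitization_mul +%R.
Proof.
move=> [a x] [b y] [c z]; rewrite /unitization_mul /=; congr pair.
  by rewrite mulrDl.
by rewrite linearDl scalerDl scalerDr /= [X in X + _]addrACA [LHS]addrACA.
Qed.

Fact unitization_mulDr : right_distributive unitization_mul +%R.
Proof.
move=> [a x] [b y] [c z]; rewrite /unitization_mul /=; congr pair.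
  by rewrite mulrDr.
by rewrite linearDr scalerDl scalerDr /= [X in X + _]addrACA [LHS]addrACA.
Qed.

Fact unitization_one_neq0 : (1, 0) != 0 :> B.
Proof. by apply/eqP => -[/eqP]; rewrite oner_eq0. Qed.

HB.instance Definition _ := GRing.Zmodule_isNzRing.Build B unitization_mulA
  unitization_mul1l unitization_mul1r unitization_mulDl unitization_mulDr
  unitization_one_neq0.

Definition to_unitization (x : A) : B := (0, x).

Fact to_unitization_is_zmod_morphism : zmod_morphism to_unitization.
Proof. by move=> x y; congr pair; rewrite subrr. Qed.

HB.instance Definition _ :=
  GRing.isZmodMorphism.Build A B to_unitization to_unitization_is_zmod_morphism.

Definition of_unitization (x : B) : A := x.2.

Fact of_unitization_is_zmod_morphism : zmod_morphism of_unitization.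
Proof. by []. Qed.

HB.instance Definition _ :=
  GRing.isZmodMorphism.Build B A of_unitization of_unitization_is_zmod_morphism.

Lemma to_unitizationK : cancel to_unitization of_unitization.
Proof. by []. Qed.

Lemma to_unitizationM : {morph to_unitization : x y / mul x y >-> x * y}.
Proof.
move=> x y; rewrite /to_unitization; congr pair; rewrite ?mul0r //.
by rewrite !scale0r !add0r.
Qed.

Lemma to_unitization_lie :
  {morph to_unitization : x y / lie_bracket mul x y >-> commutator x y}.
Proof. by move=> x y; rewrite raddfB /= !to_unitizationM. Qed.

Lemma to_unitization_iter_mul n x :
  to_unitization (iter n (mul x) x) = to_unitization x ^+ n.+1.
Proof. by elim: n => //= n IHn; rewrite to_unitizationM IHn -exprS. Qed.

Lemma pchar_unitization p : p \in [pchar k] -> p \in [pchar B].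
Proof.
move=> pchark; rewrite inE (pcharf_prime pchark) /=; apply/eqP.
have natE n : (n%:R : B) = (n%:R, 0).
  by elim: n => // n IHn; rewrite !mulrSr IHn; congr pair; rewrite addr0.
by rewrite natE (pcharf0 pchark).
Qed.

End Unitization.

Section NonUnital.
Context (k : fieldType) (p : nat) (pchark : p \in [pchar k]).
Context (A : lmodType k) (mul : {bilinear A -> A -> A}) (mulA : associative mul).
Implicit Types x y : A.

Let p_prime : prime p := pcharf_prime pchark.
Let p_gt0 : (0 < p)%N := prime_gt0 p_prime.
Let pcharB := pchar_unitization mulA pchark.
Local Notation iota := (@to_unitization k A mul mulA).

(** This is [ad (x ^+ p) = (ad x) ^+ p]: for want of a unit, the [p]-th power
    of [x] is written [iter p.-1 (mul x) x]. *)
Lemma iter_lie_bracket_pchar x y :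
  iter p (lie_bracket mul x) y = lie_bracket mul (iter p.-1 (mul x) x) y.
Proof.
apply: (can_inj (to_unitizationK mulA)).
rewrite to_unitization_lie to_unitization_iter_mul prednK //.
rewrite -(iter_commutator_pchar pcharB).
by elim: p => //= n IHn; rewrite to_unitization_lie IHn.
Qed.

(** Sequences of elements of [A] multiply as polynomials over the
    unitization. *)
Lemma coef_iter_commutator (c f : nat -> A) (C F : {poly unitization mulA})
    n m :
  (forall i, iota (c i) = C`_i) -> (forall i, iota (f i) = F`_i) ->
  iota (iter n (lambda_ext (lie_bracket mul) c) f m) =
  (iter n (commutator C) F)`_m.
Proof.
move=> cC fF; elim: n m => [|n IHn] m; first exact: fF.
rewrite !iterS coefB coefM coefMr -sumrB raddf_sum; apply: eq_bigr => i _.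
by rewrite /= to_unitization_lie cC IHn.
Qed.

(** Jacobson's formula: for [0 < i < p], [jacobson_s mul p i x y] is the
    coefficient of [lambda ^+ i] in the [p]-th power of [lambda x + y]. *)
Lemma iter_mulD_pchar x y :
  iter p.-1 (mul (x + y)) (x + y) =
  iter p.-1 (mul x) x + iter p.-1 (mul y) y
  + \sum_(1 <= i < p) jacobson_s mul p i x y.
Proof.
rewrite -[LHS](to_unitizationK mulA) to_unitization_iter_mul prednK // raddfD.
rewrite (exprD_affine_coef pcharB) !raddfD raddf_sum /=.
congr (_ + _ + _).
- by rewrite -{1}(prednK p_gt0) -to_unitization_iter_mul.
- by rewrite -{1}(prednK p_gt0) -to_unitization_iter_mul.
rewrite !big_nat; apply: eq_bigr => -[|i] // /andP[_ ip]; rewrite /jacobson_s /=.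
set w := iter _ _ _ i.
pose c := (iota x)%:P * 'X + (iota y)%:P.
have -> : w = of_unitization (c ^+ p)`_i.+1 *+ i.+1.
  rewrite -raddfMn (coef_affine_exp_pchar pcharB) -[w](to_unitizationK mulA).
  congr of_unitization; apply: coef_iter_commutator => -[|[|j]];
    by rewrite ?coefD ?coefMX ?coefC ?coefCM /= ?coefC ?add0r ?addr0 ?raddf0.
rewrite -scaler_nat scalerA mulVf ?scale1r //.
by rewrite -(dvdn_pcharf pchark) gtnNdvd.
Qed.

End NonUnital.

(** * Rota-Baxter operators of weight zero *)

Section RotaBaxter.
Context (k : fieldType) (A : lmodType k) (mul : {bilinear A -> A -> A}).
Context (mulA : associative mul) (beta : {linear A -> A}).
Implicit Types x y z : A.

Definition rb_star x y : A := mul x (beta y) + mul (beta x) y.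

Fact rb_star_bilinear : bilinear_for *:%R *:%R rb_star.
Proof.
split=> [z | z] a x y; rewrite /rb_star linearP !(linearPl, linearPr) /=;
  by rewrite scalerDr addrACA.
Qed.

HB.instance Definition _ :=
  bilinear_isBilinear.Build k A A A *:%R *:%R rb_star rb_star_bilinear.

Definition rb_bracket x y : A := lie_bracket mul (beta x) y.

Fact rb_bracket_bilinear : bilinear_for *:%R *:%R rb_bracket.
Proof.
rewrite /rb_bracket /lie_bracket; split=> [z | z] a x y /=.
  by rewrite linearP linearPl linearPr /= opprD addrACA scalerBr.
by rewrite linearPl linearPr /= opprD addrACA scalerBr.
Qed.

HB.instance Definition _ :=
  bilinear_isBilinear.Build k A A A *:%R *:%R rb_bracket rb_bracket_bilinear.

Lemma lie_rb_bracket : lie_bracket rb_bracket = lie_bracket rb_star.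
Proof.
apply/boolp.funext => x; apply/boolp.funext => y.
rewrite /lie_bracket /rb_bracket /lie_bracket /rb_star.
rewrite opprB addrC opprD addrACA; congr (_ + _); exact: addrC.
Qed.

(** The Jacobi identity in the form that expresses [ad] of a bracket. *)
Lemma lie_bracket_lie a b z :
  lie_bracket mul (lie_bracket mul a b) z =
  lie_bracket mul a (lie_bracket mul b z)
  - lie_bracket mul b (lie_bracket mul a z).
Proof.
rewrite /lie_bracket !(linearBl, linearBr) /= !mulA.
set P := mul (mul a b) z; set Q := mul (mul a z) b; set S := mul (mul z b) a.
set R := mul (mul b z) a; set T := mul (mul b a) z; set U := mul (mul z a) b.
rewrite !opprB [RHS]addrACA !addrA !subrK.
by rewrite [LHS]addrAC [P - T - U]addrAC [LHS]addrAC.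
Qed.

Hypothesis betaM : forall x y, mul (beta x) (beta y) = beta (rb_star x y).

(** Both bracketings are the sum of the three products of [x], [y], [z] in
    which [beta] is applied to all factors but one. *)
Lemma rb_starA : associative rb_star.
Proof.
move=> x y z; rewrite [LHS]/rb_star [RHS]/rb_star -!betaM /rb_star.
by rewrite !(linearDl, linearDr) /= !mulA addrA.
Qed.

Lemma rb_iter_star n x :
  beta (iter n (rb_star x) x) = iter n (mul (beta x)) (beta x).
Proof. by elim: n => //= n IHn; rewrite -betaM IHn. Qed.

Lemma rb_lie_bracket x y :
  beta (lie_bracket rb_bracket x y) = lie_bracket mul (beta x) (beta y).
Proof. by rewrite lie_rb_bracket /lie_bracket linearB /= -!betaM. Qed.

Lemma rb_bracket_pre_lie : pre_lie rb_bracket.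
Proof.
split=> [|x y z]; first exact: rb_bracket_bilinear.
(* Both sides are the commutator with [z] of the commutator of [beta x] and
   [beta y]. *)
have E : rb_bracket x (rb_bracket y z) - rb_bracket y (rb_bracket x z) =
         rb_bracket (rb_bracket x y) z - rb_bracket (rb_bracket y x) z.
  transitivity (rb_bracket (lie_bracket rb_bracket x y) z); last first.
    by rewrite [lie_bracket _ _ _]/lie_bracket linearBl.
  by rewrite /rb_bracket rb_lie_bracket lie_bracket_lie.
by apply/eqP; rewrite subr_eq addrAC -addrA [eqbRHS]addrC -subr_eq E.
Qed.

(** [beta] turns powers for [rb_star] into powers for [mul], so the power map
    of the associative product [rb_star] is a [p]-map: its additivity defect
    and its adjoint action are the classical ones for the commutator of
    [rb_star], which is also the Lie bracket of [rb_bracket]. *)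
Theorem rb_restricted_pre_lie (p : nat) : p \in [pchar k] ->
  restricted_pre_lie p rb_bracket (fun x => iter p.-1 (rb_star x) x).
Proof.
move=> pchark; have p_gt0 := prime_gt0 (pcharf_prime pchark).
have left x y :
    rb_bracket (iter p.-1 (rb_star x) x) y = iter p (rb_bracket x) y.
  by rewrite /rb_bracket rb_iter_star -(iter_lie_bracket_pchar pchark mulA).
split=> [|a x|//|x y|x y].
- exact: rb_bracket_pre_lie.
- rewrite -[p in a ^+ p](prednK p_gt0).
  elim: p.-1 => [|n IHn] /=; first by rewrite expr1.
  by rewrite IHn linearZl_LR linearZr_LR /= scalerA -exprS.
- rewrite lie_rb_bracket (iter_lie_bracket_pchar pchark rb_starA).
  rewrite -lie_rb_bracket.
  by rewrite -left /lie_bracket subKr.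
- rewrite (iter_mulD_pchar pchark rb_starA); congr (_ + _).
  by apply: eq_bigr => i _; rewrite /jacobson_s lie_rb_bracket.
Qed.

End RotaBaxter.

(** * The Rota-Baxter operator of a quasitriangular algebra *)

Section Sandwich.
Context (k : fieldType) (A : lmodType k) (mul : {bilinear A -> A -> A}).
Context (mulA : associative mul).

Definition sandwich n (u v : 'I_n -> A) (x : A) : A :=
  \sum_i mul (mul (u i) x) (v i).

Lemma sandwich_linear n (u v : 'I_n -> A) : linear (sandwich u v).
Proof.
move=> a x y; rewrite /sandwich scaler_sumr -big_split /=.
by apply: eq_bigr => i _; rewrite linearPr linearPl.
Qed.

HB.instance Definition _ n (u v : 'I_n -> A) :=
  GRing.isLinear.Build k A A *:%R (sandwich u v) (sandwich_linear u v).

Lemma prelie_prodE n (u v : 'I_n -> A) :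
  prelie_prod mul u v = rb_bracket mul (sandwich u v).
Proof.
apply/boolp.funext => x; apply/boolp.funext => y.
rewrite /prelie_prod /rb_bracket /lie_bracket /sandwich linear_sumlz linear_sumr.
by congr (_ - _); apply: eq_bigr => i _; rewrite !mulA.
Qed.

(** [a \ot b |-> mul (mul a x) b] factors through the tensor product. This
    matters because the Yang-Baxter equation is known for one decomposition of
    the tensor, while the pre-Lie product is written with another. *)
Lemma sandwich_tensor n (u v : 'I_n -> A) m (u' v' : 'I_m -> A) :
  \sum_i u i \ot v i = \sum_i u' i \ot v' i ->
  sandwich u v = sandwich u' v'.
Proof.
move=> ruv; apply/boolp.funext => x.
have bil : bilinear_for *:%R *:%R (fun a b => mul (mul a x) b).
  by split=> [b|a] c y z /=; rewrite ?linearPl ?linearPr.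
have [g g_lin gE] := tensor_lift_ex bil.
pose G : {linear tensor A A -> A} :=
  HB.pack g (GRing.isLinear.Build k (tensor A A) A *:%R g g_lin).
have sum_G j (s t : 'I_j -> A) : G (\sum_i s i \ot t i) = sandwich s t x.
  by rewrite raddf_sum; apply: eq_bigr => i _; exact: gE.
by rewrite -!sum_G ruv.
Qed.

(** The map [a \ot b \ot c |-> a x b y c] sends the associative Yang-Baxter
    equation to the Rota-Baxter identity for [sandwich u v]. *)
Lemma sandwich_rota_baxter n (u v : 'I_n -> A) :
  \sum_i \sum_j mul (u i) (u j) \ot v j \ot v i
  - \sum_i \sum_j u i \ot mul (v i) (u j) \ot v j
  + \sum_i \sum_j u j \ot u i \ot mul (v i) (v j) = 0 ->
  forall x y, mul (sandwich u v x) (sandwich u v y) =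
              sandwich u v (rb_star mul (sandwich u v) x y).
Proof.
move=> aybe x y.
have bil2 : bilinear_for *:%R *:%R (fun a b => mul (mul (mul a x) b) y).
  by split=> [b|a] c s t /=; rewrite ?(linearPl, linearPr).
have [g g_lin gE] := tensor_lift_ex bil2.
have bil3 : bilinear_for *:%R *:%R (fun t c => mul (g t) c).
  by split=> [c|t] a s s' /=; rewrite ?g_lin ?linearPl ?linearPr.
have [h h_lin hE] := tensor_lift_ex bil3.
have [H HE] : exists H : {linear tensor (tensor A A) A -> A},
    forall a b c, H (a \ot b \ot c) = mul (mul (mul (mul a x) b) y) c.
  pose H : {linear tensor (tensor A A) A -> A} :=
    HB.pack h (GRing.isLinear.Build k (tensor (tensor A A) A) A *:%R h h_lin).
  exists H.
  by move=> a b c; rewrite [LHS]hE gE.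
have H1 : H (\sum_i \sum_j mul (u i) (u j) \ot v j \ot v i) =
          sandwich u v (mul (sandwich u v x) y).
  rewrite raddf_sum; apply: eq_bigr => i _; rewrite raddf_sum.
  rewrite linear_sumlz linear_sumr linear_sumlz.
  by apply: eq_bigr => j _; rewrite /= HE !mulA.
have H2 : H (\sum_i \sum_j u i \ot mul (v i) (u j) \ot v j) =
          mul (sandwich u v x) (sandwich u v y).
  rewrite raddf_sum linear_sumlz; apply: eq_bigr => i _.
  rewrite raddf_sum linear_sumr.
  by apply: eq_bigr => j _; rewrite /= HE !mulA.
have H3 : H (\sum_i \sum_j u j \ot u i \ot mul (v i) (v j)) =
          sandwich u v (mul x (sandwich u v y)).
  rewrite exchange_big raddf_sum; apply: eq_bigr => i _; rewrite raddf_sum.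
  rewrite !linear_sumr linear_sumlz.
  by apply: eq_bigr => j _; rewrite /= HE !mulA.
have /(congr1 H) := aybe; rewrite raddfD raddfB raddf0 /= H1 H2 H3 => /eqP.
by rewrite addrAC subr_eq0 -linearD /= addrC => /eqP ->.
Qed.

End Sandwich.

Theorem proposition4p2 (k : fieldType) (p : nat) (hp : p \in [pchar k])
    (A : lmodType k) (mul : A -> A -> A) (r : tensor A A)
    (hA : quasitriangular_eps_bialgebra mul r)
    (n : nat) (u v : 'I_n -> A) (hr : r = \sum_i u i \ot v i) :
  exists pmap : A -> A, restricted_pre_lie p (prelie_prod mul u v) pmap.
Proof.
have [mul_bil mulA [m [u' [v' [ruv' aybe]]]]] := hA.
pose M : {bilinear A -> A -> A} :=
  HB.pack mul (bilinear_isBilinear.Build k A A A *:%R *:%R mul mul_bil).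
have MA : associative M by [].
have sandwich_eq : sandwich M u v = sandwich M u' v'.
  by apply: sandwich_tensor; rewrite -hr.
rewrite -[prelie_prod _ _ _]/(prelie_prod M u v) (prelie_prodE MA).
exists (fun x => iter p.-1 (rb_star M (sandwich M u v) x) x).
apply: (rb_restricted_pre_lie MA) hp => x y.
by rewrite /rb_star /= sandwich_eq; exact: (sandwich_rota_baxter MA).
Qed.
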